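(* For all $M\in\mathrm{GL}(2n,\mathbb{R})$, there exist a symplectic matrix $S\in\mathrm{Sp}_n(\mathbb{R})$ and a strictly lower triangular matrix $T\in \mathrm{M}_{n\times n}(\mathbb{R})$ such that $$MS=\begin{pmatrix} I_n & T\\ \ast & \ast\end{pmatrix},$$ where the matrix is written in $n\times n$ blocks and $\ast$ denotes arbitrary (unspecified) blocks.
   Context: $\mathrm{M}_{n\times n}(\mathbb{R})$ is the set of real $n\times n$ matrices, $I_n$ is the identity matrix, and $\mathrm{Sp}_n(\mathbb{R})=\{A\in\mathrm{GL}(2n,\mathbb{R})\mid {}^tAJA=J\}$ with $J=\begin{pmatrix}0&I_n\\-I_n&0\end{pmatrix}$. A matrix $T=(t_{ij})$ is strictly lower triangular if $t_{ij}=0$ for all $i\le j$. *)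

(* Defs.v *)
From HB Require Import structures.
From mathcomp Require Import all_boot all_order all_algebra.
From mathcomp Require Import reals.

Set Implicit Arguments.
Unset Strict Implicit.
Unset Printing Implicit Defensive.

Import GRing.Theory.
Local Open Scope ring_scope.

(* Matrices of size 2n are typed 'M_(n + n), so that the n x n block
   decomposition is the one of block_mx. *)
Definition symplectic_form (R : realType) (n : nat) : 'M[R]_(n + n) :=
  block_mx 0 1%:M (- 1%:M) 0.

Definition symplectic (R : realType) (n : nat) (A : 'M[R]_(n + n)) : Prop :=
  A \in unitmx /\ A^T *m symplectic_form R n *m A = symplectic_form R n.

Definition strictly_lower_triangular (R : realType) (n : nat) (T : 'M[R]_n) :
    Prop :=
  forall i j : 'I_n, (i <= j)%N -> T i j = 0.

(* Main.v *)
(** The top half [row_mx A B] of [M] has full rank, and it suffices to find a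
symmetric [Sg] with [P := A + B Sg] invertible: a lower shear turns [(A, B)]
into [(P, B)], the symplectic matrix [diag(P^-1, P^T)] turns this into
[(1, B P^T)], and an upper shear adds any symmetric matrix to the second
block, which can cancel its entries on and above the diagonal.

[Sg] is built by raising the rank of [A] one step at a time. If [y B v != 0] for
some [y] and [v] with [y A = 0] and [A v = 0], then adding [B v v^T] to [A]
shrinks its kernel. Otherwise fix such [y] and [v], both nonzero; then
[B v = A p] for some [p], and [w := y B] is nonzero by full rank and kills
[ker A]. The increment [t (w^T v^T + v w)] of [Sg] then shrinks the kernel, for
any [t != 0] with [1 + t w p != 0]. *)
Require Import Defs.
From HB Require Import structures.
From mathcomp Require Import all_boot all_order all_algebra.
From mathcomp Require Import reals.

Set Implicit Arguments.
Unset Strict Implicit.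
Unset Printing Implicit Defensive.

Import GRing.Theory.
Local Open Scope ring_scope.

Lemma mulmx_tr_eq0 (R : realDomainType) (n : nat) (v : 'cV[R]_n) :
  v^T *m v = 0 -> v = 0.
Proof.
move=> /matrixP /(_ ord0 ord0); rewrite !mxE => /eqP.
rewrite Num.Theory.psumr_eq0 => [/allP vv0|i _]; last first.
  by rewrite mxE -expr2 Num.Theory.sqr_ge0.
apply/matrixP => i j; rewrite (ord1 j) [RHS]mxE.
have := vv0 i (mem_index_enum i); rewrite mxE /= -expr2.
by rewrite sqrf_eq0 => /eqP.
Qed.

(** Column kernels are encoded as row kernels of transposes. The vector [v] makes the inclusion of
    kernels strict, and rank-nullity turns this into a strict inequality of ranks. *)
Lemma rank_lt_ker (F : fieldType) (m n : nat) (A A' : 'M[F]_(m, n))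
    (v : 'cV[F]_n) :
    (forall z : 'cV[F]_n, A' *m z = 0 -> A *m z = 0) ->
    A *m v = 0 -> A' *m v != 0 ->
  (\rank A < \rank A')%N.
Proof.
move=> sub Av A'v.
have : (kermx A'^T < kermx A^T)%MS.
  apply/andP; split.
    apply/rV_subP => z /sub_kermxP zA'; apply/sub_kermxP.
    apply: trmx_inj; rewrite trmx_mul trmxK trmx0; apply: sub.
    by apply: trmx_inj; rewrite trmx_mul trmxK trmx0.
  apply: contraNN A'v => /(submx_trans _) sub'.
  have /sub_kermxP/(congr1 trmx) : (v^T <= kermx A'^T)%MS.
    by apply: sub'; apply/sub_kermxP; rewrite -trmx_mul Av trmx0.
  by rewrite -trmx_mul trmxK trmx0 => ->.
rewrite ltmxErank => /andP[_]; rewrite !mxrank_ker !mxrank_tr.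
by rewrite ltn_sub2lE ?rank_leq_col //.
Qed.

(** Fredholm alternative: the column space of [A] is the annihilator of its left kernel, which is
    spanned by the rows of the transpose of [cokermx A^T]. *)
Lemma submx_tr_ann (F : fieldType) (m n : nat) (A : 'M[F]_(m, n))
    (b : 'cV[F]_m) :
    (forall y : 'rV[F]_m, y *m A = 0 -> y *m b = 0) ->
  exists p : 'cV[F]_n, b = A *m p.
Proof.
move=> ann; have : (b^T <= A^T)%MS.
  rewrite submxE; apply/eqP; apply: trmx_inj; rewrite trmx_mul trmxK trmx0.
  apply/row_matrixP => i; rewrite row_mul row0; apply: ann.
  rewrite -row_mul -[A in _ *m A]trmxK -trmx_mul mulmx_coker.
  by rewrite trmx0 row0.
by move=> /submxP[p /(congr1 trmx)]; rewrite trmxK trmx_mul trmxK; exists p^T.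
Qed.

Lemma sym_rank_increase (R : realFieldType) (n : nat) (A B : 'M[R]_n) :
    row_free (row_mx A B) -> (\rank A < n)%N ->
  exists2 Sg : 'M[R]_n, Sg^T = Sg & (\rank A < \rank (A + B *m Sg)%R)%N.
Proof.
move=> freeAB rkA.
have scal (m : nat) (x : 'cV[R]_m) (c : 'M[R]_1) : x *m c = c 0 0 *: x.
  by rewrite [c in LHS]mx11_scalar mul_mx_scalar.
have scal0 (c : 'M[R]_1) : c 0 0 = 0 -> c = 0.
  by move=> c0; rewrite [c]mx11_scalar c0 raddf0.
have vv (v : 'cV[R]_n) : v != 0 -> (v^T *m v) 0 0 != 0.
  by move=> v0; apply: contraNneq v0 => /scal0 /mulmx_tr_eq0 ->.
have kerA (v : 'cV[R]_n) : A *m v = 0 -> (v^T <= kermx A^T)%MS.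
  by move=> Av; apply/sub_kermxP; rewrite -trmx_mul Av trmx0.
(* The rows of [kermx A] span the left kernel and the columns of [(kermx A^T)^T] the right one, so
   this single product tests [y B v] for all pairs at once. *)
have [ann|/eqP] := eqVneq (kermx A *m B *m (kermx A^T)^T) 0; last first.
  move=> /matrixP ann.
  have [i [j Kij]] : exists i j, (kermx A *m B *m (kermx A^T)^T) i j != 0.
    have [/existsP[i /existsP[j]]|/existsPn K0] :=
      boolP [exists i, exists j, (kermx A *m B *m (kermx A^T)^T) i j != 0].
      by exists i, j.
    case: ann => i j; rewrite [RHS]mxE; apply/eqP.
    by have /existsPn/(_ j) := K0 i; rewrite negbK.
  pose y := row i (kermx A); pose v := (row j (kermx A^T))^T.
  have yA : y *m A = 0 by rewrite -row_mul mulmx_ker row0.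
  have Av : A *m v = 0.
    by rewrite -[A in A *m _]trmxK -trmx_mul -row_mul mulmx_ker row0 trmx0.
  have yBv : (y *m B *m v) 0 0 != 0.
    by rewrite /y /v tr_row colE -row_mul mulmxA -row_mul -colE 2!mxE.
  have v0 : v != 0 by apply: contraNneq yBv => ->; rewrite mulmx0 mxE.
  exists (v *m v^T); first by rewrite trmx_mul trmxK.
  have E (z : 'cV[R]_n) : (A + B *m (v *m v^T)) *m z
      = A *m z + (v^T *m z) 0 0 *: (B *m v).
    by rewrite mulmxDl !mulmxA -!(mulmxA _ _ z) scal.
  (* Multiplying by [y] removes [A z] and leaves [(v^T z) (y B v)]. Hence the new kernel is
     orthogonal to [v], so it lies in the old one and misses [v] itself. *)
  have yE (z : 'cV[R]_n) : (A + B *m (v *m v^T)) *m z = 0 -> (v^T *m z) 0 0 = 0.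
    move/(congr1 (mulmx y)).
    rewrite E mulmx0 mulmxDr mulmxA yA mul0mx add0r -scalemxAr mulmxA.
    move/matrixP/(_ 0 0); rewrite [LHS]mxE [RHS]mxE => /eqP.
    by rewrite mulf_eq0 (negPf yBv) orbF => /eqP.
  apply: (@rank_lt_ker _ _ _ _ _ v) => // [z Ez|].
    by move: (Ez); rewrite E yE // scale0r addr0.
  by apply: contra_neq (vv _ v0) => /yE.
have {}ann (y : 'rV[R]_n) (v : 'cV[R]_n) :
    y *m A = 0 -> A *m v = 0 -> y *m B *m v = 0.
  move=> /sub_kermxP/submxP[c ->] /kerA/submxP[d /(congr1 trmx)].
  rewrite trmxK trmx_mul => ->.
  by rewrite mulmxA -2!(mulmxA c) ann mulmx0 mul0mx.
have [v v0 Av] : exists2 v : 'cV[R]_n, v != 0 & A *m v = 0.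
  have : kermx A^T != 0.
    by rewrite -mxrank_eq0 mxrank_ker mxrank_tr subn_eq0 -ltnNge.
  move=> /rowV0Pn[z /sub_kermxP zA z0]; exists z^T; first by rewrite trmx_eq0.
  by apply: trmx_inj; rewrite trmx_mul trmxK trmx0.
have [y y0 yA] : exists2 y : 'rV[R]_n, y != 0 & y *m A = 0.
  have : kermx A != 0 by rewrite -mxrank_eq0 mxrank_ker subn_eq0 -ltnNge.
  by move=> /rowV0Pn[y /sub_kermxP yA y0]; exists y.
have [|p Bv] := @submx_tr_ann _ _ _ A (B *m v).
  by move=> x xA; rewrite mulmxA ann.
have [w wE] : exists w, y *m B = w by exists (y *m B).
have w0 : w^T != 0.
  rewrite trmx_eq0; apply: contraNneq y0 => w0.
  have: y *m row_mx A B = 0 by rewrite mul_mx_row yA wE w0 row_mx0.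
  by rewrite -[RHS](mul0mx _ (row_mx A B)) => /(row_free_inj freeAB) ->.
have ww : (w *m w^T) 0 0 != 0 by have := vv _ w0; rewrite trmxK.
(* The choice [t = 1] fails only if [w p = -1]; then [t = -1] gives the value 2. *)
have [t t0 tp] : exists2 t : R, t != 0 & 1 + t * (w *m p) 0 0 != 0.
  have [e|] := eqVneq (1 + 1 * (w *m p) 0 0) 0.
    exists (-1); first by rewrite oppr_eq0 oner_eq0.
    move/eqP: e; rewrite mul1r addrC addr_eq0 => /eqP ->.
    by rewrite mulrNN mulr1 -(natrD _ 1 1) Num.Theory.pnatr_eq0.
  by exists 1; rewrite ?oner_eq0.
exists (t *: (w^T *m v^T + v *m w)).
  by rewrite linearZ /= linearD /= !trmx_mul !trmxK addrC.
(* Since [B v = A p], the contribution of [v w] is absorbed into the argument of [A]. The other term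
   is detected by [y], because [y B w^T = w w^T] is nonzero. *)
have E (z : 'cV[R]_n) : (A + B *m (t *: (w^T *m v^T + v *m w))) *m z
    = A *m (z + (t * (w *m z) 0 0) *: p)
      + (t * (v^T *m z) 0 0) *: (B *m w^T).
  rewrite mulmxDl mulmxDr -addrA; congr (_ + _).
  rewrite -scalemxAr -scalemxAl mulmxDr mulmxDl !mulmxA.
  rewrite -(mulmxA _ v^T z) -(mulmxA _ w z).
  by rewrite !scal Bv -scalemxAr scalerDr !scalerA addrC.
have yE (z : 'cV[R]_n) :
    (A + B *m (t *: (w^T *m v^T + v *m w))) *m z = 0 -> (v^T *m z) 0 0 = 0.
  move/(congr1 (mulmx y)).
  rewrite E mulmxDr mulmxA yA mul0mx add0r mulmx0 -scalemxAr mulmxA wE.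
  move/matrixP/(_ 0 0); rewrite [LHS]mxE [RHS]mxE => /eqP.
  by rewrite !mulf_eq0 (negPf t0) (negPf ww) orbF => /eqP.
apply: (@rank_lt_ker _ _ _ _ _ v) => // [z Ez|]; last first.
  by apply: contra_neq (vv _ v0) => /yE.
move: (Ez); rewrite E yE // mulr0 scale0r addr0 => Az.
suff wz : (w *m z) 0 0 = 0 by move: Az; rewrite wz mulr0 scale0r addr0.
(* [w] kills [ker A], hence [(w z) (1 + t (w p)) = 0]. *)
have := ann _ _ yA Az; rewrite wE mulmxDr -scalemxAr.
move=> /matrixP/(_ 0 0); rewrite [LHS]mxE [X in _ + X]mxE [RHS]mxE => /eqP.
rewrite mulrAC -[X in X + _]mul1r -mulrDl mulf_eq0 (negPf tp) /=.
by move=> /eqP.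
Qed.

(** Induction on the corank of [A]; the symmetric increments add up. *)
Lemma sym_unit_shear (R : realFieldType) (n : nat) (A B : 'M[R]_n) :
    row_free (row_mx A B) ->
  exists2 Sg : 'M[R]_n, Sg^T = Sg & A + B *m Sg \in unitmx.
Proof.
have [k] := ubnP (n - \rank A); elim: k A => // k IHk A.
rewrite ltnS => lek free.
have [rkA|] := ltnP (\rank A) n; last first.
  move=> rkA; exists 0; first exact: trmx0.
  by rewrite mulmx0 addr0 -row_free_unit /row_free eqn_leq rkA rank_leq_row.
have [Sg Sgs rkSg] := sym_rank_increase free rkA.
have [||Sg' Sg's u] := IHk (A + B *m Sg).
- by apply: leq_trans lek; apply: ltn_sub2l.
(* The shear has determinant 1, so the new pair keeps full row rank. *)
- have -> : row_mx (A + B *m Sg) B = row_mx A B *m block_mx 1%:M 0 Sg 1%:M.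
    by rewrite mul_row_block !mulmx1 mulmx0 add0r.
  rewrite /row_free mxrankMfree // row_free_unit unitmxE det_lblock !det1 mulr1.
  exact: unitr1.
exists (Sg + Sg'); first by rewrite linearD /= Sgs Sg's.
by rewrite mulmxDr addrA.
Qed.

(** With [J] the symplectic form, [J^2 = -1], so [- J S^T J] is a left inverse of [S]. *)
Lemma symplectic_preserve (R : realType) (n : nat) (S : 'M[R]_(n + n)) :
  S^T *m symplectic_form R n *m S = symplectic_form R n -> symplectic S.
Proof.
move=> SJS; split=> //.
have : (- symplectic_form R n *m S^T *m symplectic_form R n) *m S = 1%:M.
  rewrite -!mulmxA (mulmxA S^T) SJS mulNmx /symplectic_form mulmx_block.
  rewrite !(mul0mx, mulmx0, mul1mx, mulmx1, mulNmx, mulmxN, addr0, add0r).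
  by rewrite opp_block_mx !oppr0 opprK -scalar_mx_block.
by move=> /mulmx1_unit[].
Qed.

Lemma symplectic_mul (R : realType) (n : nat) (S S' : 'M[R]_(n + n)) :
  symplectic S -> symplectic S' -> symplectic (S *m S').
Proof.
move=> [_ SJS] [_ SJS']; apply: symplectic_preserve.
by rewrite trmx_mul -!mulmxA (mulmxA S^T) (mulmxA _ S) SJS mulmxA SJS'.
Qed.

Lemma symplectic_lshear (R : realType) (n : nat) (Sg : 'M[R]_n) :
  Sg^T = Sg -> symplectic (block_mx 1%:M 0 Sg 1%:M).
Proof.
move=> Sgs; apply: symplectic_preserve.
rewrite /symplectic_form tr_block_mx !mulmx_block.
rewrite !trmx1 trmx0 Sgs.
rewrite !(mul0mx, mulmx0, mul1mx, mulmx1, mulNmx, mulmxN, addr0, add0r).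
by rewrite addNr.
Qed.

Lemma symplectic_ushear (R : realType) (n : nat) (Sg : 'M[R]_n) :
  Sg^T = Sg -> symplectic (block_mx 1%:M Sg 0 1%:M).
Proof.
move=> Sgs; apply: symplectic_preserve.
rewrite /symplectic_form tr_block_mx !mulmx_block.
rewrite !trmx1 trmx0 Sgs.
rewrite !(mul0mx, mulmx0, mul1mx, mulmx1, mulNmx, mulmxN, addr0, add0r).
by rewrite addNr.
Qed.

Lemma symplectic_diag (R : realType) (n : nat) (P : 'M[R]_n) :
  P \in unitmx -> symplectic (block_mx (invmx P) 0 0 P^T).
Proof.
move=> uP; apply: symplectic_preserve.
rewrite /symplectic_form tr_block_mx !mulmx_block.
rewrite !trmx0 trmxK trmx_inv.
rewrite !(mul0mx, mulmx0, mul1mx, mulmx1, mulNmx, mulmxN, addr0, add0r).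
by rewrite mulVmx ?unitmx_tr // mulmxV.
Qed.

Theorem theorem4p3 (R : realType) (n : nat) (M : 'M[R]_(n + n))
    (hM : M \in unitmx) :
  exists (S : 'M[R]_(n + n)) (T : 'M[R]_n),
    [/\ symplectic S, strictly_lower_triangular T &
        exists C D : 'M[R]_n, M *m S = block_mx 1%:M T C D].
Proof.
have free : row_free (row_mx (ulsubmx M) (ursubmx M)).
  (* The upper left block of [M M^-1 = 1] says that the left half of [M^-1] is a right inverse of
     the top half of [M]. *)
  rewrite hsubmxK; apply/row_freeP; exists (lsubmx (invmx M)).
  rewrite mul_usub_mx mulmx_lsub mulmxV //.
  by rewrite scalar_mx_block block_mxEh row_mxKl col_mxKu.
have [Sg Sgs uP] := sym_unit_shear free.
set P := _ + _ in uP; pose Q := ursubmx M *m P^T.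
(* [Q] need not be symmetric: its upper triangle, diagonal included, is reflected and negated, so
   that [Th + Q] vanishes there. *)
pose Th := - \matrix_(i, j) if (i <= j)%N then Q i j else Q j i.
have Ths : Th^T = Th.
  apply/matrixP => i j; rewrite !mxE.
  by case: ltngtP => // /val_inj ->.
pose S := block_mx 1%:M 0 Sg 1%:M *m block_mx (invmx P) 0 0 P^T
          *m block_mx 1%:M Th 0 1%:M.
exists S, (Th + Q); split.
- apply: symplectic_mul (symplectic_ushear Ths).
  exact: symplectic_mul (symplectic_lshear Sgs) (symplectic_diag uP).
- by move=> i j leij; rewrite !mxE leij addNr.
rewrite -[M]submxK /S !mulmxA !mulmx_block.
rewrite !(mul0mx, mulmx0, mul1mx, mulmx1, addr0, add0r) -/P mulmxV // mul1mx.
by do 2!eexists.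
Qed.
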